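(* Let $n\ge 1$ be an integer and let $X$ be an $S(n)$-space. Then $X$ is $S(n)$-functionally compact ($S(n)FC$) if and only if for every infinite set $A\subseteq X$ both of the following hold: (i) $A$ $\theta(n)$-converges to the set $B$ of all its $\theta(n)$-complete accumulation points; (ii) whenever $C\subseteq X$ is a $\theta^n$-closed set such that $A$ does not $\theta(n)$-converge to $X\setminus C$, then $C$ is a complete accumulation set of $A$.
   Context: All neighborhoods are open; $\overline{M}=\mathrm{cl}\,M$ is the closure in the space $X$. $\theta^n$-closure: $\mathrm{cl}_{\theta^0}M=\mathrm{cl}\,M$; for $n\ge 1$, $x\notin \mathrm{cl}_{\theta^n}M$ iff there are open neighborhoods $U_1,\dots,U_n$ of $x$ with $\mathrm{cl}\,U_i\subseteq U_{i+1}$ for $i=1,\dots,n-1$ and $\mathrm{cl}\,U_n\cap M=\emptyset$. A set $M$ is $\theta^n$-closed if $M=\mathrm{cl}_{\theta^n}M$. The $\theta^n$-interior is $\mathrm{Int}_{\theta^n}M=X\setminus \mathrm{cl}_{\theta^n}(X\setminus M)$. For $n\ge1$, $X$ is an $S(n)$-space if $x\notin\mathrm{cl}_{\theta^n}\{y\}$ for any two distinct points $x,y\in X$. An $S(n)$-space $X$ is $S(n)FC$ if every continuous function from $X$ onto an $S(n)$-space is a closed function. An $n$-hull of a point $x$ is a neighborhood $U$ of $x$ for which there are neighborhoods $U_1,\dots,U_n=U$ of $x$ with $\mathrm{cl}\,U_i\subseteq U_{i+1}$ for $i=1,\dots,n-1$. A point $x$ is a $\theta(n)$-complete accumulation point of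 an infinite set $F$ if $|F\cap\overline U|=|F|$ for every $n$-hull $U$ of $x$. A set $C$ is a complete accumulation set of a set $A$ if $|U\cap A|=|A|$ for every open set $U\supseteq C$. For $k\ge 0$, an $S(k)$-cover of a subset $B\subseteq X$ is a family $\{U_\alpha\}$ of open subsets of $X$ such that $B\subseteq\bigcup_\alpha \mathrm{Int}_{\theta^k}U_\alpha$. A set $A$ $\theta(n)$-converges to a set $B$ if for every $S(n-1)$-cover $\gamma$ of $B$ there is a finite family $\{U_{\alpha_i}\}_{i=1}^k\subseteq\gamma$ such that $|A\setminus \bigcup_{i=1}^k\overline{U_{\alpha_i}}|<|A|$. *)

(* Defs.v *)
From HB Require Import structures.
From mathcomp Require Import all_boot all_order.
From mathcomp Require Import boolp classical_sets functions cardinality filter topology.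

Set Implicit Arguments.
Unset Strict Implicit.
Unset Printing Implicit Defensive.

Local Open Scope classical_set_scope.
Local Open Scope card_scope.

Definition card_lt {T U : Type} (A : set T) (B : set U) : Prop :=
  A #<= B /\ A #!= B.

(* Chains are indexed from 1, as U_1, ..., U_n; the values of [U] at 0 and
   above [n] are irrelevant. *)
Definition nbhs_chain {X : topologicalType} (n : nat) (x : X)
    (U : nat -> set X) : Prop :=
  (forall i, (1 <= i <= n)%N -> open_nbhs x (U i)) /\
  (forall i, (1 <= i < n)%N -> closure (U i) `<=` U i.+1).

Definition theta_closure {X : topologicalType} (n : nat) (M : set X) : set X :=
  if n is 0 then closure M
  else [set x | ~ exists U : nat -> set X,
                    nbhs_chain n x U /\ closure (U n) `&` M = set0].

Definition theta_closed {X : topologicalType} (n : nat) (M : set X) : Prop :=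
  M = theta_closure n M.

Definition theta_interior {X : topologicalType} (n : nat) (M : set X) : set X :=
  ~` theta_closure n (~` M).

(* Meant for [1 <= n]. *)
Definition S_space (n : nat) (X : topologicalType) : Prop :=
  forall x y : X, x <> y -> ~ theta_closure n [set y] x.

Definition closed_function {X Y : topologicalType} (f : X -> Y) : Prop :=
  forall D : set X, closed D -> closed (f @` D).

Definition S_FC (n : nat) (X : topologicalType) : Prop :=
  S_space n X /\
  forall (Y : topologicalType) (f : X -> Y),
    S_space n Y -> continuous f -> set_surj [set: X] [set: Y] f ->
    closed_function f.

(* Meant for [1 <= n]. *)
Definition hull {X : topologicalType} (n : nat) (x : X) (U : set X) : Prop :=
  exists V : nat -> set X, nbhs_chain n x V /\ V n = U.

Definition theta_complete_accumulation_point {X : topologicalType} (n : nat)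
    (F : set X) (x : X) : Prop :=
  forall U : set X, hull n x U -> F `&` closure U #= F.

Definition complete_accumulation_set {X : topologicalType}
    (A C : set X) : Prop :=
  forall U : set X, open U -> C `<=` U -> U `&` A #= A.

Definition S_cover {X : topologicalType} (k : nat) (B : set X)
    (gamma : set (set X)) : Prop :=
  gamma `<=` open /\ B `<=` \bigcup_(U in gamma) theta_interior k U.

(* Meant for [1 <= n]; [n.-1] is then the genuine predecessor. *)
Definition theta_converges {X : topologicalType} (n : nat)
    (A B : set X) : Prop :=
  forall gamma : set (set X), S_cover n.-1 B gamma ->
    exists delta : set (set X),
      [/\ finite_set delta, delta `<=` gamma &
          card_lt (A `\` \bigcup_(U in delta) closure U) A].

(* Main.v *)
(* Both conditions are equivalent to the following covering property: if [C]
   is theta^n-closed, [U] is open and contains [C], and [gamma] is an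
   S(n-1)-cover of the complement of [C], then finitely many closures of
   members of [gamma] cover the complement of [U].
   - A point outside f(D) has a theta^n-closed fibre contained in the
     complement of D, so the covering property makes f closed. Conversely,
     collapse C to a point and let its neighborhoods be the open sets
     containing the complement of finitely many closures of members of a
     refinement of [gamma]; this quotient is an S(n)-space, and closedness of
     the quotient map is the covering property.
   - The covering property gives (i) by adjoining to [gamma] the hulls whose
     closures meet A in fewer than |A| points, and (ii) directly. Conversely,
     (ii) alone suffices: if the covering property fails, a subset A of the
     complement of U that is not finitely covered and has least cardinality
     does not theta(n)-converge to the complement of C, although U contains C
     and misses A. *)
Require Import Defs.
From HB Require Import structures.
From mathcomp Require Import all_boot all_order.
From mathcomp Require Import boolp classical_sets functions cardinality filter topology.

Local Open Scope classical_set_scope.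
Local Open Scope card_scope.

(** * Cardinality *)

Lemma card_le_fun {T U : Type} (A : set T) (B : set U) (f : T -> U) :
  set_fun A B f -> set_inj A f -> A #<= B.
Proof.
move=> fAB finj; have [g] : $|{injfun A >-> B}| by apply/injfunPex; exists f.
exact: inj_card_le.
Qed.

Lemma card_le_ex_fun {T : Type} {A B : set T} :
  A #<= B -> exists2 f : T -> T, set_fun A B f & set_inj A f.
Proof.
elim/Ppointed: T A B => T A B; last by move/pcard_leP/injfunPex.
by exists id => x; case: (no x).
Qed.

(* Zorn applied to the sets of choice functions of [F] that are pairwise
   distinct at every coordinate: a maximal such set must exhaust some
   coordinate, and the member of [F] at that coordinate is smallest. *)
Lemma card_le_minimum {T : Type} (F : set (set T)) :
  F !=set0 -> exists2 S, F S & forall S', F S' -> S #<= S'.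
Proof.
move=> [S0 FS0].
pose P (M : set (set T -> T)) :=
  (forall f S, M f -> F S -> S (f S)) /\
  (forall f g S, M f -> M g -> F S -> f S = g S -> f = g).
have [|M [[MF Minj] Mmax]] := @Zorn_bigcup _ P.
  move=> H HP Htot; split=> [f S [M HM Mf]|f g S [M HM Mf] [N HN Ng]].
    exact: (HP _ HM).1.
  have [MN|NM] := Htot _ _ HM HN.
    by apply: (HP _ HN).2 => //; exact: MN.
  by apply: (HP _ HM).2 => //; exact: NM.
have [[S FS Ssurj]|nosurj] := pselect (exists2 S, F S &
    forall x, S x -> exists2 f, M f & f S = x).
  exists S => // S' FS'.
  have /choice[h hP] : forall x, exists y,
      S x -> exists f, [/\ M f, f S = x & y = f S'].
    (* When [M] exhausts the coordinate [S], sending [f S] to [f S'] is injective, since members of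
       [M] that agree at [S'] coincide. *)
    move=> x; have [Sx|nSx] := pselect (S x); last by exists x.
    by have [f Mf fx] := Ssurj _ Sx; exists (f S') => _; exists f.
  apply: (@card_le_fun _ _ _ _ h) => [x /hP[f [Mf _ ->]]|]; first exact: (MF f).
  move=> x y /set_mem/hP[f [Mf <- ->]] /set_mem/hP[g [Mg <- ->]] fg.
  by rewrite (Minj f g S').
have out S : F S -> exists2 x, S x & forall f, M f -> f S <> x.
  move=> FS; apply: contrapT => nx; apply: nosurj; exists S => // x Sx.
  apply: contrapT => nf; apply: nx; exists x => // f Mf fx.
  by apply: nf; exists f.
have [x0 _ _] := out _ FS0.
have /choice[g gP] : forall S, exists x,
    F S -> S x /\ forall f, M f -> f S <> x.
  move=> S; have [FS|nFS] := pselect (F S); last by exists x0.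
  by have [x Sx xP] := out _ FS; exists x.
exfalso; apply: (Mmax (M `|` [set g])).
  split=> [f|]; first by move=> Mf; left.
  by move=> /(_ g (or_intror erefl)) Mg; exact: (gP _ FS0).2 Mg erefl.
split=> [f S [Mf|->] FS|f f' S [Mf|->] [Mf'|->] FS //].
- exact: (MF f).
- exact: (gP S FS).1.
- exact: Minj.
- by move=> fg; case: ((gP _ FS).2 _ Mf).
- by move=> fg; case: ((gP _ FS).2 _ Mf').
Qed.

Lemma card_le_total {T : Type} (A B : set T) : A #<= B \/ B #<= A.
Proof.
have [|S [->|->] Smin] := @card_le_minimum _ [set S | S = A \/ S = B].
- by exists A; left.
- by left; apply: Smin; right.
- by right; apply: Smin; left.
Qed.

(** Comparability of cardinals turns strict inequality into a negation, the form in which smallness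
    is proved and refuted below. *)
Lemma card_ltNge {T : Type} (A B : set T) : card_lt A B <-> ~ (B #<= A).
Proof.
split=> [[AB /negP nAB] BA|nBA].
  by apply: nAB; rewrite card_eq_le AB BA.
have [AB|//] := card_le_total A B; split=> //.
by rewrite card_eq_le AB; exact/negP.
Qed.

Lemma infinite_set_seq {T : Type} (A : set T) : infinite_set A ->
  exists2 s : nat -> T, forall k, A (s k) & injective s.
Proof.
elim/Ppointed: T A => T A Ainf.
  by have [x _] := infinite_setN0 Ainf; case: (no x).
have /infiniteP/pcard_leP/injfunPex[s sA sinj] := Ainf.
by exists s => [k|k l]; [exact: sA|apply: sinj; rewrite in_setT].
Qed.

(** Hilbert's hotel: along an injective sequence [s] in [A], a new point [x] goes to [s 0], each
    [s k] moves to [s k.+1], and all other points stay fixed. *)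
Lemma infinite_setU1 {T : Type} (A : set T) (x : T) :
  infinite_set A -> A `|` [set x] #<= A.
Proof.
move=> /infinite_set_seq[s sA sinj].
have [Ax|nAx] := pselect (A x).
  by apply: subset_card_le => y [//|->].
have /choice[h hP] : forall y, exists z, [/\ y = x -> z = s 0,
    forall k, y = s k -> z = s k.+1 &
    y <> x -> (forall k, y <> s k) -> z = y].
  move=> y; have [->|nyx] := pselect (y = x).
    by exists (s 0); split=> // k xs; case: nAx; rewrite xs; exact: sA.
  have [[k ->]|nys] := pselect (exists k, y = s k).
    exists (s k.+1); split=> [sx|l /sinj->//|_ /(_ k)//].
    by case: nAx; rewrite -sx; exact: sA.
  by exists y; split=> // k ys; case: nys; exists k.
have cases y : [\/ y = x, exists k, y = s k | y <> x /\ forall k, y <> s k].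
  have [|nyx] := pselect (y = x); first by constructor 1.
  have [|nys] := pselect (exists k, y = s k); first by constructor 2.
  by constructor 3; split=> // k ys; apply: nys; exists k.
apply: (@card_le_fun _ _ _ _ h) => [y Ay|y z _ _].
  have [h0 hS hid] := hP y.
  have [/h0->//|[k /hS->//]|[nyx nys]] := cases y.
  by rewrite hid //; case: Ay.
have [h0 hS hid] := hP y; have [h0' hS' hid'] := hP z.
have [yx|[k yk]|[nyx nys]] := cases y; have [zx|[l zl]|[nzx nzs]] := cases z.
- by rewrite yx zx.
- by rewrite (h0 yx) (hS' _ zl) => /sinj.
- by rewrite (h0 yx) (hid' nzx nzs) => /esym/nzs.
- by rewrite (hS _ yk) (h0' zx) => /sinj.
- by rewrite (hS _ yk) (hS' _ zl) yk zl => /sinj[->].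
- by rewrite (hS _ yk) (hid' nzx nzs) => /esym/nzs.
- by rewrite (hid nyx nys) (h0' zx) => /nys.
- by rewrite (hid nyx nys) (hS' _ zl) => /nys.
- by rewrite (hid nyx nys) (hid' nzx nzs).
Qed.

Lemma infinite_setU_finite {T : Type} (A R : set T) :
  infinite_set A -> finite_set R -> A `|` R #<= A.
Proof.
move=> Ainf [n]; elim: n R => [|n IH] R.
  by rewrite II0 card_eq0 => /eqP->; rewrite setU0 card_lexx.
move=> /eq_cardSP[x Rx /IH Rle].
apply: card_le_trans Rle; rewrite -{1}(setD1K Rx) [x |` _]setUC setUA.
apply: infinite_setU1; apply: contra_not Ainf.
by apply: sub_finite_set; exact: subsetUl.
Qed.

(* A maximal family of pairwise disjoint injective sequences in [B] leaves
   out only finitely many points, and each sequence splits into its even and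
   odd terms. *)
Lemma infinite_setX_bool {T : Type} (B : set T) :
  infinite_set B -> B `*` [set: bool] #<= B.
Proof.
move=> Binf.
pose P (M : set (nat -> T)) := (forall s k, M s -> B (s k)) /\
  (forall s t k l, M s -> M t -> s k = t l -> s = t /\ k = l).
have [|M [[MB Minj] Mmax]] := @Zorn_bigcup _ P.
  move=> H HP Htot; split=> [s k [M HM Ms]|s t k l [M HM Ms] [N HN Nt]].
    exact: (HP _ HM).1.
  have [MN|NM] := Htot _ _ HM HN.
    by apply: (HP _ HN).2 => //; exact: MN.
  by apply: (HP _ HM).2 => //; exact: NM.
pose E := [set x | exists s k, M s /\ x = s k].
have EB : E `<=` B by move=> _ [s [k [Ms ->]]]; exact: MB.
have Rfin : finite_set (B `\` E).
  apply: contrapT => /infinite_set_seq[s sR sinj].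
  apply: (Mmax (M `|` [set s])).
    split=> [t|]; first by move=> Mt; left.
    move=> /(_ s (or_intror erefl)) Ms.
    by apply: (sR 0).2; exists s, 0.
  split=> [t k [Mt|->]|t t' k l [Mt|->] [Mt'|->]].
  - exact: (MB t).
  - exact: (sR k).1.
  - exact: Minj.
  - by move=> ts; case: (sR l).2; exists t, k.
  - by move=> st; case: (sR k).2; exists t', l.
  - by move=> /sinj.
have BE : B = E `|` (B `\` E) by rewrite setDUK.
have Einf : infinite_set E.
  by move=> Efin; apply: Binf; rewrite BE finite_setU.
have B_le_E : B #<= E by rewrite {1}BE; exact: infinite_setU_finite.
have EE : E `*` [set: bool] #<= E.
  have /choice[h hP] : forall p : T * bool, exists y, E p.1 ->
      exists s k, [/\ M s, p.1 = s k & y = s (p.2 + k.*2)].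
    move=> [x b]; have [[s [k [Ms xs]]]|nEx] := pselect (E x).
      by exists (s (b + k.*2)) => _; exists s, k.
    by exists x.
  apply: (@card_le_fun _ _ _ _ h).
    by move=> p [/hP[s [k [Ms _ ->]]] _]; exists s, (p.2 + k.*2).
  move=> [x b] [y c] /set_mem[/hP/= [s [k [Ms -> ->]]] _].
  move=> /set_mem[/hP/= [t [l [Mt -> ->]]] _] /Minj[] // <- bc.
  have [bE kE] : b = c /\ k = l.
    split; last by have := congr1 half bc; rewrite !half_bit_double.
    by have := congr1 odd bc; rewrite !oddD !odd_double !addbF !oddb.
  by rewrite bE kE.
apply: card_le_trans (subset_card_le EB); apply: card_le_trans EE.
have [f fBE finj] := card_le_ex_fun B_le_E.
apply: (@card_le_fun _ _ _ _ (fun p => (f p.1, p.2))).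
  by move=> [x b] [/= /fBE].
move=> [x b] [y c] /set_mem[/= Bx _] /set_mem[/= By _] [fxy ->].
by rewrite (finj x y) ?inE.
Qed.

(** Let [B2] be the larger set. If [A] embedded in the union, [B2] would be infinite; the union
    embeds in [B2] times [bool], hence in [B2], and so [A] would embed in [B2]. *)
Lemma card_lt_setU {T : Type} (A B1 B2 : set T) : infinite_set A ->
  card_lt B1 A -> card_lt B2 A -> card_lt (B1 `|` B2) A.
Proof.
move=> Ainf; wlog B12 : B1 B2 / B1 #<= B2 => [wlog1 ltB1 ltB2|].
  have [|] := card_le_total B1 B2; first by move/wlog1; apply.
  by rewrite setUC => /wlog1; apply.
move=> _ /card_ltNge nAB2; apply/card_ltNge => AB.
have [B2fin|B2inf] := pselect (finite_set B2).
  apply: Ainf; apply: card_le_finite AB _; rewrite finite_setU; split=> //.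
  exact: card_le_finite B12 B2fin.
apply: nAB2; apply: (card_le_trans AB).
apply: card_le_trans (infinite_setX_bool _ B2inf).
have [f fB finj] := card_le_ex_fun B12.
have /choice[h hP] : forall x, exists p : T * bool,
    (B1 x -> p = (f x, true)) /\ (~ B1 x -> p = (x, false)).
  move=> x; have [Bx|nBx] := pselect (B1 x); first by exists (f x, true).
  by exists (x, false).
apply: (@card_le_fun _ _ _ _ h) => [x|x y _ _].
  move=> B12x; have [Bx|nBx] := pselect (B1 x).
    by rewrite (hP x).1 //; split=> //; exact: fB.
  by rewrite (hP x).2 //; split=> //; case: B12x.
have [Bx|nBx] := pselect (B1 x); have [By|nBy] := pselect (B1 y).
- by rewrite (hP x).1 // (hP y).1 // => -[]; apply: finj; rewrite inE.
- by rewrite (hP x).1 // (hP y).2.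
- by rewrite (hP x).2 // (hP y).1.
- by rewrite (hP x).2 // (hP y).2 // => -[].
Qed.

Lemma card_lt_bigcup {I T : Type} (A : set T) (D : set I) (F : I -> set T) :
  infinite_set A -> finite_set D -> (forall i, D i -> card_lt (F i) A) ->
  card_lt (\bigcup_(i in D) F i) A.
Proof.
move=> Ainf [n]; elim: n D => [|n IH] D.
  rewrite II0 card_eq0 => /eqP-> _; rewrite bigcup_set0.
  apply/card_ltNge; rewrite card_le0 => /eqP A0; apply: Ainf.
  by rewrite A0; exact: finite_set0.
move=> /eq_cardSP[i Di DiI] ltF; rewrite -(setD1K Di) bigcup_setU1.
apply: card_lt_setU => //; first exact: ltF.
by apply: IH => // j [Dj _]; exact: ltF.
Qed.

(** * Hulls and S(n)-spaces *)

Lemma closure_preimage {X Y : topologicalType} (f : X -> Y) (A : set Y) :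
  continuous f -> closure (f @^-1` A) `<=` f @^-1` closure A.
Proof. by move=> fc x xA B /fc /xA[z [Afz Bfz]]; exists (f z). Qed.

(** The left side is the complement of the interior of [closure A], and an open [A] lies in that
    interior. *)
Lemma closure_setC_closure {X : topologicalType} (A : set X) :
  open A -> closure (~` closure A) `<=` ~` A.
Proof.
move=> oA; rewrite closure_setC; apply: subsetC.
by rewrite -open_subsetE //; exact: subset_closure.
Qed.

Lemma closed_bigcup_finite {X : topologicalType} (delta : set (set X)) :
  finite_set delta -> closed (\bigcup_(U in delta) closure U).
Proof. by move=> fd; apply: closed_bigcup => // U _; exact: closed_closure. Qed.

Lemma nbhs_chain_closureS {X : topologicalType} {n : nat} {x : X}
    {U : nat -> set X} (i : nat) :
  nbhs_chain n x U -> (1 <= i <= n)%N -> closure (U i) `<=` closure (U n).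
Proof.
move=> [_ Ucl] /andP[i1]; elim: n Ucl => [|n IH] Ucl.
  by case: i i1.
rewrite leq_eqVlt => /predU1P[->//|lt_in].
apply: subset_trans (IH _ lt_in) _.
  by move=> j /andP[j1 jn]; apply: Ucl; rewrite j1 ltnW.
apply: closureS; apply: subset_trans (Ucl n _); first exact: subset_closure.
by rewrite ltnSn andbT (leq_trans i1).
Qed.

Lemma nbhs_chainI {X : topologicalType} (n : nat) (x : X) (U V : nat -> set X) :
  nbhs_chain n x U -> nbhs_chain n x V ->
  nbhs_chain n x (fun i => U i `&` V i).
Proof.
move=> [Ux Ucl] [Vx Vcl]; split=> i ni; first exact: open_nbhsI (Ux i ni) (Vx i ni).
by apply: subset_trans (@closureI _ _ _) _; apply: setISS; [exact: Ucl|exact: Vcl].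
Qed.

Lemma nbhs_chain_preimage {X Y : topologicalType} {n : nat} (f : X -> Y) {x : X}
    {W : nat -> set Y} : continuous f ->
  nbhs_chain n (f x) W -> nbhs_chain n x (fun i => f @^-1` W i).
Proof.
move=> fc [Wx Wcl]; split=> i ni.
  by have [oW Wfx] := Wx i ni; split=> //; move/continuousP: fc; exact.
apply: subset_trans (closure_preimage f _ fc) _.
by apply: preimage_subset; exact: Wcl.
Qed.

(* Reversing a chain: the complements of the closures form a chain at every
   point outside the last closure. *)
Lemma nbhs_chain_setC {X : topologicalType} {n : nat} {x y : X}
    {U : nat -> set X} :
  nbhs_chain n x U -> ~ closure (U n) y ->
  nbhs_chain n y (fun i => ~` closure (U (n.+1 - i))).
Proof.
move=> chU nUy; have [Ux Ucl] := chU; split=> i /andP[i1 ni].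
  split; first by rewrite openC; exact: closed_closure.
  apply: contra_not nUy; apply: (nbhs_chain_closureS _ chU).
  by rewrite subn_gt0 ltnS ni /= leq_subLR -addn1 addnC leq_add2r.
(* The closure of the [i]-th complement misses the open set [U (n.+1 - i)], which contains
   [closure (U (n - i))]. *)
apply: subset_trans (closure_setC_closure _ _) _.
  by apply: (Ux _ _).1; rewrite subn_gt0 ltnS (ltnW ni) /= leq_subLR -addn1 addnC leq_add2r.
apply: subsetC; rewrite subSS subSn; last exact: ltnW.
by apply: Ucl; rewrite subn_gt0 ni /= -{2}(subn0 n) ltn_sub2l // (leq_ltn_trans _ ni).
Qed.

Lemma hull_open_nbhs {X : topologicalType} {n : nat} {x : X} {U : set X} :
  (1 <= n)%N -> hull n x U -> open_nbhs x U.
Proof. by move=> n1 [V [[Vx _] <-]]; apply: Vx; rewrite n1 leqnn. Qed.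

Lemma hullT {X : topologicalType} (n : nat) (x : X) : hull n x [set: X].
Proof. by exists (fun=> setT); split=> //; split=> // i _; exact: open_nbhsT. Qed.

Lemma hullI {X : topologicalType} (n : nat) (x : X) (U V : set X) :
  hull n x U -> hull n x V -> hull n x (U `&` V).
Proof.
move=> [U' [chU <-]] [V' [chV <-]]; exists (fun i => U' i `&` V' i).
by split=> //; exact: nbhs_chainI.
Qed.

Lemma hull_preimage {X Y : topologicalType} {n : nat} (f : X -> Y) {x : X}
    {W : set Y} : continuous f -> hull n (f x) W -> hull n x (f @^-1` W).
Proof.
move=> fc [V [chV <-]]; exists (fun i => f @^-1` V i); split=> //.
exact: nbhs_chain_preimage.
Qed.

Lemma notin_theta_closure {X : topologicalType} (n : nat) (M : set X) (x : X) :
  (1 <= n)%N ->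
  ~ theta_closure n M x <->
  exists2 U, hull n x U & closure U `&` M = set0.
Proof.
case: n => // n _; split=> [/contrapT[U [chU UM]]|[_ [U [chU <-]] UM]].
  by exists (U n.+1) => //; exists U.
by apply; exists U.
Qed.

Lemma theta_closedP {X : topologicalType} (n : nat) (C : set X) :
  (1 <= n)%N ->
  theta_closed n C <->
  forall x, ~ C x -> exists2 U, hull n x U & closure U `&` C = set0.
Proof.
move=> n1; split=> [CE x nCx|Chull].
  by apply/notin_theta_closure => //; rewrite -CE.
apply/seteqP; split=> x; last first.
  by move=> Cx; apply: contrapT => /Chull/notin_theta_closure; exact.
move=> Cx; apply: contrapT => /(notin_theta_closure _ _ _ n1)[U hU UC].
suff : (closure U `&` C) x by rewrite UC.
by split=> //; apply: subset_closure; have [] := hull_open_nbhs n1 hU.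
Qed.

(** For [n = 1] both sides say that [x] lies in the open set [U]. For larger [n], a chain of length
    [n.-1] whose last closure lies in [U] is extended by [U] itself; conversely, the last member of
    an [n]-chain is dropped. Thus S(n-1)-covers are open families that contain an [n]-hull of every
    point of the set. *)
Lemma theta_interiorP {X : topologicalType} (n : nat) (U : set X) (x : X) :
  (1 <= n)%N -> open U -> theta_interior n.-1 U x <-> hull n x U.
Proof.
case: n => // -[|n] _ oU; rewrite /theta_interior.
  have -> : theta_closure 1.-1 (~` U) = ~` U° by rewrite -closure_setC.
  rewrite setCK; split=> [/interior_subset Ux|hU].
    by exists (fun=> U); split=> //; split=> // i; case: i => [|[]].
  by have [_ ?] := hull_open_nbhs (ltn0Sn 0) hU; exact: open_nbhs_nbhs.
split.
  move/notin_theta_closure => -[]// _ [V [[Vx Vcl] <-]] /disjoints_subset.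
  rewrite setCK => VU; exists (fun i => if (i <= n.+1)%N then V i else U).
  rewrite ltnn; split=> //; split=> i /andP[i1 ni].
    case: ifPn => [ni'|_]; first by apply: Vx; rewrite i1.
    split=> //; apply/VU/subset_closure.
    by have [] // := Vx n.+1; rewrite ltnSn.
  rewrite (ni : (i <= n.+1)%N); case: ltnP => [ni'|ni']; first by apply: Vcl; rewrite i1.
  by have -> : i = n.+1 by apply/eqP; rewrite eqn_leq ni' andbT -ltnS.
move=> [V [[Vx Vcl] <-]]; apply/notin_theta_closure => //.
exists (V n.+1); last by apply/disjoints_subset; rewrite setCK; apply: Vcl; exact: ltnSn.
exists V; split=> //; split=> i /andP[i1 ni].
  by apply: Vx; rewrite i1 ltnW.
by apply: Vcl; rewrite i1 ltnW.
Qed.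

Lemma S_coverP {X : topologicalType} (n : nat) (B : set X) (gamma : set (set X)) :
  (1 <= n)%N ->
  S_cover n.-1 B gamma <->
  gamma `<=` open /\ forall x, B x -> exists2 U, gamma U & hull n x U.
Proof.
move=> n1; split=> -[og Bg]; split=> // x /Bg[U gU Ux]; exists U => //.
  by apply/theta_interiorP => //; exact: og.
by apply/theta_interiorP => //; exact: og.
Qed.

Lemma S_spaceP {X : topologicalType} (n : nat) : (1 <= n)%N ->
  S_space n X <->
  forall x y : X, x <> y -> exists2 U, hull n x U & ~ closure U y.
Proof.
move=> n1; split=> SX x y xy.
  have /notin_theta_closure[//|U hU Uy] := SX x y xy.
  by exists U => // cUy; suff : (closure U `&` [set y]) y by rewrite Uy.
apply/notin_theta_closure => //; have [U hU nUy] := SX x y xy.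
by exists U => //; apply/disjoints_subset => z Uz zy; apply: nUy; rewrite -zy.
Qed.

(** The reversed chain at [y] ends in the complement of [closure (W 1)], whose closure misses the
    neighborhood [W 1] of [x]. *)
Lemma hull_separation_sym {X : topologicalType} {n : nat} {x y : X} {U : set X} :
  (1 <= n)%N -> hull n x U -> ~ closure U y ->
  exists2 V, hull n y V & ~ closure V x.
Proof.
move=> n1 [W [chW <-]] nWy; exists (~` closure (W 1)).
  exists (fun i => ~` closure (W (n.+1 - i))); rewrite subSnn; split=> //.
  exact: (nbhs_chain_setC chW).
have [oW Wx] := chW.1 1%N n1.
by move=> /(closure_setC_closure _ oW).
Qed.

(** * Finite covers by closures and the collapsed space *)

Definition closures_cover {X : topologicalType} (gamma : set (set X))
    (F : set X) : Prop :=
  exists delta : set (set X), [/\ finite_set delta, delta `<=` gamma &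
    F `<=` \bigcup_(U in delta) closure U].

Lemma closures_coverS {X : topologicalType} {gamma : set (set X)} {F G : set X} :
  F `<=` G -> closures_cover gamma G -> closures_cover gamma F.
Proof.
move=> FG [delta [fd dg Gd]]; exists delta; split=> //.
exact: subset_trans FG Gd.
Qed.

Lemma closures_cover0 {X : topologicalType} (gamma : set (set X)) :
  closures_cover gamma set0.
Proof. by exists set0; split=> //; exact: finite_set0. Qed.

Lemma closures_cover_closure {X : topologicalType} (gamma : set (set X))
    (U : set X) :
  gamma U -> closures_cover gamma (closure U).
Proof.
move=> gU; exists [set U]; split; first exact: finite_set1.
  by move=> _ ->.
by rewrite bigcup_set1.
Qed.

Lemma closures_coverU {X : topologicalType} (gamma : set (set X)) (F G : set X) :
  closures_cover gamma F -> closures_cover gamma G ->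
  closures_cover gamma (F `|` G).
Proof.
move=> [d [fd dg Fd]] [e [fe eg Ge]]; exists (d `|` e); split.
- by rewrite finite_setU.
- by rewrite subUset.
- by rewrite bigcup_setU; exact: setUSS.
Qed.

Lemma closures_cover_refine {X : topologicalType} (gamma gamma' : set (set X))
    (F : set X) :
  (forall V, gamma' V -> exists2 W, gamma W & V `<=` W) ->
  closures_cover gamma' F -> closures_cover gamma F.
Proof.
move=> ref [d [fd dg Fd]].
have /choice[h hP] : forall V, exists W, gamma' V -> gamma W /\ V `<=` W.
  move=> V; have [/ref[W gW VW]|ngV] := pselect (gamma' V); first by exists W.
  by exists V.
exists (h @` d); split; first exact: finite_image.
  by move=> _ [V dV <-]; have [] := hP _ (dg _ dV).
move=> x /Fd[V dV Vx]; exists (h V); first by exists V.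
by apply: closureS Vx; have [] := hP _ (dg _ dV).
Qed.

Lemma closures_cover_finite {X : topologicalType} (gamma : set (set X))
    (F : set X) :
  finite_set F -> (forall x, F x -> exists2 U, gamma U & closure U x) ->
  closures_cover gamma F.
Proof.
move=> Ffin Fg.
have /choice[h hP] : forall x, exists U, F x -> gamma U /\ closure U x.
  move=> x; have [/Fg[U gU Ux]|nFx] := pselect (F x); first by exists U.
  by exists set0.
exists (h @` F); split; first exact: finite_image.
  by move=> _ [x Fx <-]; have [] := hP _ Fx.
by move=> x Fx; exists (h x); [exists x|have [] := hP _ Fx].
Qed.

(** The covering property through which the two sides of the equivalence are compared. *)
Definition theta_compact (n : nat) (X : topologicalType) : Prop :=
  forall (C : set X) (gamma : set (set X)) (U : set X),
    theta_closed n C -> S_cover n.-1 (~` C) gamma -> open U -> C `<=` U ->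
    closures_cover gamma (~` U).

(* The quotient of [X] identifying the points of [C] (to [None]), with the
   neighborhoods of [None] restricted to those containing the complement of a
   finite union of closures of members of [gamma]. *)
Definition collapse {X : topologicalType} (C : set X) (gamma : set (set X)) :
  Type := option (~` C).

HB.instance Definition _ (X : topologicalType) (C : set X)
  (gamma : set (set X)) := Choice.on (collapse C gamma).

Definition collapse_map {X : topologicalType} (C : set X)
    (gamma : set (set X)) (x : X) : collapse C gamma := insub x.

Definition collapse_open {X : topologicalType} (C : set X)
    (gamma : set (set X)) (W : set (collapse C gamma)) : Prop :=
  open (collapse_map C gamma @^-1` W) /\
  (W None -> closures_cover gamma (collapse_map C gamma @^-1` ~` W)).

Section collapse_topology.
Context (X : topologicalType) (C : set X) (gamma : set (set X)).
Local Notation pi := (collapse_map C gamma).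

Lemma collapse_openT : collapse_open C gamma setT.
Proof.
split=> [|_]; first by rewrite preimage_setT; exact: openT.
by rewrite setCT preimage_set0; exact: closures_cover0.
Qed.

Lemma collapse_openI : setI_closed (collapse_open C gamma).
Proof.
move=> V W [oV cV] [oW cW]; split; first exact: openI.
by move=> [VN WN]; rewrite setCI preimage_setU; apply: closures_coverU; auto.
Qed.

Lemma collapse_open_bigcup (I : Type) (F : I -> set (collapse C gamma)) :
  (forall i, collapse_open C gamma (F i)) ->
  collapse_open C gamma (\bigcup_i F i).
Proof.
move=> oF; split.
  by rewrite preimage_bigcup; apply: bigcup_open => i _; have [] := oF i.
move=> [i _ FN]; have [_ /(_ FN)] := oF i; apply: closures_coverS.
by apply: preimage_subset; apply: subsetC; exact: bigcup_sup.
Qed.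

HB.instance Definition _ := isOpenTopological.Build (collapse C gamma)
  collapse_openT collapse_openI collapse_open_bigcup.

Lemma collapse_openE (W : set (collapse C gamma)) :
  open W = collapse_open C gamma W.
Proof. by []. Qed.

Lemma collapse_map_continuous : continuous pi.
Proof. by apply/continuousP => W; rewrite collapse_openE => -[]. Qed.

Lemma collapse_mapC (x : X) : pi x = None <-> C x.
Proof.
rewrite /collapse_map; case: insubP => [u|].
  by rewrite inE => nCx _; split.
by rewrite notin_setE => /contrapT.
Qed.

Lemma collapse_map_inj (x y : X) : pi x = pi y -> x = y \/ C x /\ C y.
Proof.
rewrite /collapse_map; case: insubP => [u _ <-|].
  by case: insubP => // v _ <- [->]; left.
case: insubP => // nCy nCx _; right; move: nCx nCy.
by rewrite !notin_setE => /contrapT Cx /contrapT Cy.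
Qed.

Lemma collapse_map_surj : C !=set0 -> set_surj [set: X] [set: collapse C gamma] pi.
Proof.
move=> [c Cc] [u|] _; first by exists (val u) => //; exact: valK.
by exists c => //; apply/collapse_mapC.
Qed.

Lemma collapse_preimage_image (A : set X) : A `&` C = set0 ->
  pi @^-1` (pi @` A) = A.
Proof.
move=> /disjoints_subset ACd; apply/seteqP; split=> x; last exact: imageP.
by move=> [y Ay /collapse_map_inj[<-//|[/(ACd _ Ay)]]].
Qed.

Lemma collapse_imageN (A : set X) : A `&` C = set0 -> ~ (pi @` A) None.
Proof.
by move=> /disjoints_subset ACd [y Ay /collapse_mapC]; exact: ACd.
Qed.

(** The complement of the image contains [None], so its openness there demands exactly that [gamma]
    finitely cover [A]. The next lemma reads the same clause backwards, recovering a cover from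
    closedness. *)
Lemma collapse_closed_image (A : set X) : A `&` C = set0 ->
  closed A -> closures_cover gamma A -> closed (pi @` A).
Proof.
move=> ACd cA covA; rewrite -openC collapse_openE; split.
  by rewrite -openC -(collapse_preimage_image _ ACd) in cA.
by move=> _; rewrite setCK collapse_preimage_image.
Qed.

Lemma collapse_closed_cover (A : set X) : A `&` C = set0 ->
  closed (pi @` A) -> closures_cover gamma A.
Proof.
move=> ACd; rewrite -openC collapse_openE => -[_ /(_ (collapse_imageN _ ACd))].
by rewrite setCK collapse_preimage_image.
Qed.

(** All closures in the chain lie in [closure V], so they miss [C] and are finitely covered. Hence
    the images of the members are open, the images of their closures are closed, and the chain
    survives the collapse. *)
Lemma collapse_hull (n : nat) (x : X) (V : set X) : (1 <= n)%N ->
  hull n x V -> closure V `&` C = set0 -> closures_cover gamma (closure V) ->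
  hull n (pi x) (pi @` V) /\ closure (pi @` V) `<=` pi @` closure V.
Proof.
move=> n1 [U [chU <-]] UC covU.
have clU i : (1 <= i <= n)%N -> closure (U i) `&` C = set0.
  move=> ni; apply: subsetI_eq0 UC => //; exact: (nbhs_chain_closureS _ chU).
have cl i : (1 <= i <= n)%N -> closure (pi @` U i) `<=` pi @` closure (U i).
  move=> ni; rewrite [X in _ `<=` X](closure_id _).1.
    by apply: closureS; apply: image_subset; exact: subset_closure.
  apply: collapse_closed_image; [exact: clU|exact: closed_closure|].
  by apply: closures_coverS covU; exact: (nbhs_chain_closureS _ chU).
split; last by apply: cl; rewrite n1 leqnn.
exists (fun i => pi @` U i); split=> //; split=> i ni.
  have [oU Ux] := chU.1 _ ni.
  have UiC : U i `&` C = set0.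
    by apply: subsetI_eq0 (clU _ ni) => //; exact: subset_closure.
  split; last exact: imageP.
  rewrite collapse_openE; split; first by rewrite collapse_preimage_image.
  by move=> /collapse_imageN; case.
have [i1 lt_in] := andP ni; apply: subset_trans (cl i _) _; first by rewrite i1 ltnW.
by apply: image_subset; exact: chU.2.
Qed.

(** A point [x] outside [C] is separated from any other by intersecting a hull from [gamma], whose
    closure avoids [C], with a hull separating [x] in [X]. Symmetry of separation then handles the
    collapsed point. *)
Lemma collapse_S_space (n : nat) : (1 <= n)%N -> C !=set0 -> S_space n X ->
  (forall V, gamma V -> closure V `&` C = set0) ->
  (forall x, ~ C x -> exists2 V, gamma V & hull n x V) ->
  S_space n (collapse C gamma).
Proof.
move=> n1 C0 SX gC gcov; apply/S_spaceP => //.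
have sep x y : ~ C x -> pi x <> pi y ->
    exists2 W, hull n (pi x) W & ~ closure W (pi y).
  move=> nCx xy; have [V gV hV] := gcov _ nCx.
  have neq : x <> y by move=> exy; apply: xy; rewrite exy.
  have [U hU nUy] := (S_spaceP _ n1).1 SX _ _ neq.
  have clV : closure (V `&` U) `<=` closure V by apply: closureS; exact: subIsetl.
  have VUC : closure (V `&` U) `&` C = set0 by apply: subsetI_eq0 (gC _ gV).
  have [hW clW] := collapse_hull _ _ _ n1 (hullI _ _ _ _ hV hU) VUC
    (closures_coverS clV (closures_cover_closure _ _ gV)).
  exists (pi @` (V `&` U)) => // /clW[z Wz /collapse_map_inj[zy|[Cz _]]].
    by apply: nUy; rewrite -zy; have [] := closureI Wz.
  by move/disjoints_subset: VUC => /(_ _ Wz).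
move=> p q; have [x _ <-] := collapse_map_surj C0 p I.
have [y _ <-] := collapse_map_surj C0 q I => xy.
have [Cx|nCx] := pselect (C x); last exact: sep.
have nCy : ~ C y.
  by move=> /collapse_mapC Ny; apply: xy; rewrite Ny; apply/collapse_mapC.
have [W hW nWx] := sep _ _ nCy (nesym xy).
exact: hull_separation_sym hW nWx.
Qed.

End collapse_topology.

(** * The equivalence *)

Lemma theta_compact_S_FC {X : topologicalType} (n : nat) : (1 <= n)%N ->
  S_space n X -> theta_compact n X -> S_FC n X.
Proof.
move=> n1 SX cX; split=> // Y f SY fc fsurj D cD.
suff nbhsD y : ~ (f @` D) y -> exists W, [/\ closed W, f @` D `<=` W & ~ W y].
  move=> y clDy; apply: contrapT => /nbhsD[W [cW DW]]; apply.
  by have := closureS DW clDy; rewrite -(closure_id _).1.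
move=> nDy; pose C := f @^-1` [set y].
have sep x : ~ C x -> exists2 W, hull n (f x) W & ~ closure W y.
  by move=> nCx; exact: ((S_spaceP _ n1).1 SY).
have tC : theta_closed n C.
  apply/theta_closedP => // x /sep[W hW nWy].
  exists (f @^-1` W); first exact: hull_preimage.
  apply/disjoints_subset => z /(closure_preimage _ _ fc)/= Wz zy.
  by apply: nWy; rewrite -zy.
(* By [sep], each point outside the fibre [C] has an [n]-hull of this form; by continuity its
   closure maps into [closure W], away from [y]. *)
pose gamma := [set V | exists W, [/\ open W, ~ closure W y & V = f @^-1` W]].
have gC : S_cover n.-1 (~` C) gamma.
  apply/S_coverP => //; split=> [_ [W [oW _ ->]]|x /sep[W hW nWy]].
    by move/continuousP: fc; exact.
  exists (f @^-1` W); last exact: hull_preimage.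
  by exists W; split=> //; have [] := hull_open_nbhs n1 hW.
have [|delta [fd dg cov]] := cX C gamma (~` D) tC gC (closed_openC cD).
  by move=> x Cx Dx; apply: nDy; exists x.
rewrite setCK in cov.
have /choice[h hP] : forall V, exists W,
    delta V -> [/\ open W, ~ closure W y & V = f @^-1` W].
  move=> V; have [/dg[W WP]|ndV] := pselect (delta V); first by exists W.
  by exists set0.
exists (\bigcup_(W in h @` delta) closure W); split.
- by apply: closed_bigcup_finite; exact: finite_image.
- move=> _ [x /cov[V dV Vx] <-]; exists (h V); first by exists V.
  by have [_ _ VE] := hP _ dV; rewrite VE in Vx; exact: (closure_preimage _ _ fc _ Vx).
- by move=> [_ [V dV <-] hVy]; have [] := hP _ dV.
Qed.

Lemma S_FC_theta_compact {X : topologicalType} (n : nat) : (1 <= n)%N ->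
  S_FC n X -> theta_compact n X.
Proof.
move=> n1 [SX FX].
have nonempty (C : set X) gamma U : C !=set0 -> theta_closed n C ->
    S_cover n.-1 (~` C) gamma -> open U -> C `<=` U ->
    closures_cover gamma (~` U).
  move=> C0 tC /(S_coverP _ _ _ n1)[og gcov] oU CU.
  (* [collapse_S_space] needs closures that miss [C]: since [C] is theta^n-closed, intersecting
     members of [gamma] with suitable hulls achieves this and still leaves hulls. *)
  pose gamma' := [set V | (exists2 W, gamma W & V `<=` W) /\
                          closure V `&` C = set0].
  have UC : ~` U `&` C = set0.
    by rewrite setIC; apply/disjoints_subset; rewrite setCK.
  apply: (@closures_cover_refine _ gamma gamma'); first by move=> V [].
  apply: (collapse_closed_cover _ C) => //.
  apply: FX; [|exact: collapse_map_continuous|exact: collapse_map_surj|].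
    apply: collapse_S_space => // [V []//|x nCx].
    have [V gV hV] := gcov _ nCx.
    have [W hW WC] := (theta_closedP _ _ n1).1 tC _ nCx.
    exists (V `&` W); last exact: hullI.
    split; first by exists V => //; exact: subIsetl.
    by apply: subsetI_eq0 WC => //; apply: closureS; exact: subIsetr.
  by rewrite closedC.
move=> C gamma U tC gcov oU CU.
have [/set0P C0|C0] := boolP (C != set0); first exact: (nonempty C).
(* For empty [C] the collapse map misses [None] and is not onto. Instead a point [p] with a hull [V]
   in [gamma] is chosen: the nonempty case for the singleton of [p] covers the complement of [V],
   and [closure V] covers the rest. *)
have {}C0 : C = set0 by apply/eqP; move: C0; rewrite negbK.
have [[p _]|X0] := pselect ([set: X] !=set0); last first.
  apply: closures_coverS (closures_cover0 gamma) => x _.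
  by apply: X0; exists x.
move: gcov; rewrite C0 setC0 => /(S_coverP _ _ _ n1)[og gcov].
have [V gV hV] := gcov p I.
have [oV Vp] := hull_open_nbhs n1 hV.
have tp : theta_closed n [set p].
  apply/theta_closedP => // x nxp; have [W hW nWp] := (S_spaceP _ n1).1 SX _ _ nxp.
  by exists W => //; apply/disjoints_subset => z Wz zp; apply: nWp; rewrite -zp.
apply: (@closures_coverS _ _ _ (closure V `|` ~` V)).
  move=> x _; have [Vx|nVx] := pselect (V x); last by right.
  by left; exact: subset_closure.
apply: closures_coverU; first exact: closures_cover_closure.
apply: (nonempty [set p]) => //; first by exists p.
- by apply/S_coverP => //; split=> // x _; exact: gcov.
- by move=> _ ->.
Qed.

Lemma theta_compact_converges {X : topologicalType} (n : nat) (A : set X) :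
  (1 <= n)%N -> theta_compact n X -> infinite_set A ->
  theta_converges n A [set x | theta_complete_accumulation_point n A x].
Proof.
move=> n1 cX Ainf gamma /(S_coverP _ _ _ n1)[og gcov].
(* Each point that is not an accumulation point has a hull in [small], so [gamma] and [small]
   together cover the whole space; the covering property is applied with [C] and [U] empty. *)
pose small := [set U : set X | open U /\ card_lt (A `&` closure U) A].
have t0 : theta_closed n (@set0 X).
  apply/theta_closedP => // x _; exists setT; first exact: hullT.
  by rewrite setI0.
have scov : S_cover n.-1 (~` set0) (gamma `|` small).
  apply/S_coverP => //; split=> [U [/og//|[]//]|x _].
  have [/gcov[U gU hU]|nacc] := pselect (theta_complete_accumulation_point n A x).
    by exists U => //; left.
  have [U hU nU] : exists2 U, hull n x U & ~ (A `&` closure U #= A).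
    apply: contrapT => nU; apply: nacc => U hU.
    by apply: contrapT => nUA; apply: nU; exists U.
  exists U => //; right; split; first by have [] := hull_open_nbhs n1 hU.
  by split; [apply: subset_card_le; exact: subIsetl|exact/negP].
have [//|delta [fd dg cov]] := cX _ _ set0 t0 scov open0.
rewrite setC0 in cov.
exists (delta `&` gamma); split; [exact: finite_setIl|exact: subIsetr|].
apply/card_ltNge => A_le.
(* Whatever the chosen members of [gamma] leave of [A] lies in finitely many small pieces, whose
   union is still smaller than the infinite set [A]. *)
have /card_ltNge : card_lt (\bigcup_(U in delta `&` small) (A `&` closure U)) A.
  by apply: card_lt_bigcup => // [|U [_ []//]]; exact: finite_setIl.
apply; apply: card_le_trans A_le _; apply: subset_card_le => x [Ax nx].
have [U dU Ux] := cov x I; have [gU|sU] := dg _ dU.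
  by case: nx; exists U.
by exists U.
Qed.

Lemma theta_compact_accumulation_set {X : topologicalType} (n : nat)
    (A C : set X) : (1 <= n)%N -> theta_compact n X -> theta_closed n C ->
  ~ theta_converges n A (~` C) -> complete_accumulation_set A C.
Proof.
move=> n1 cX tC nconv U oU CU; apply: contrapT => /negP nUA; apply: nconv.
move=> gamma gcov; have [delta [fd dg cov]] := cX _ _ _ tC gcov oU CU.
have UA : U `&` A #<= A by apply: subset_card_le; exact: subIsetr.
(* The finite subfamily covers the complement of [U], so the leftover of [A] sits in [U], where [A]
   has fewer than [|A|] points by assumption. *)
have AU : A `\` \bigcup_(V in delta) closure V `<=` U `&` A.
  by move=> x [Ax nx]; split=> //; apply: contrapT => /cov.
exists delta; split=> //; apply/card_ltNge => A_le.
move/negP: nUA; apply; rewrite card_eq_le UA /=.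
exact: card_le_trans A_le (subset_card_le AU).
Qed.

(* The test set is a subset of [~` U] of least cardinality among those that
   [gamma] does not finitely cover: covering all of it up to fewer points
   would then cover it entirely. *)
Lemma accumulation_set_theta_compact {X : topologicalType} (n : nat) :
  (1 <= n)%N ->
  (forall A C : set X, infinite_set A -> theta_closed n C ->
     ~ theta_converges n A (~` C) -> complete_accumulation_set A C) ->
  theta_compact n X.
Proof.
move=> n1 acc C gamma U tC gcov oU CU; apply: contrapT => nocov.
have [|A [AU nA] Amin] := @card_le_minimum X
    [set A | A `<=` ~` U /\ ~ closures_cover gamma A].
  by exists (~` U); split.
have [og gC] := (S_coverP _ _ _ n1).1 gcov.
have Ainf : infinite_set A.
  move=> Afin; apply: nA; apply: closures_cover_finite => // x Ax.
  have [|V gV hV] := gC x; first by move/CU; exact: AU.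
  by exists V => //; apply: subset_closure; have [] := hull_open_nbhs n1 hV.
have nconv : ~ theta_converges n A (~` C).
  move=> /(_ _ gcov)[delta [fd dg /card_ltNge]]; apply; apply: Amin.
  split=> [x [/AU//]|cov]; apply: nA.
  apply: (@closures_coverS _ _ _
    ((A `\` \bigcup_(V in delta) closure V) `|` \bigcup_(V in delta) closure V)).
    move=> x Ax; have [dx|ndx] := pselect ((\bigcup_(V in delta) closure V) x).
      by right.
    by left.
  by apply: closures_coverU => //; exists delta; split.
(* The accumulation property equates the cardinality of [A] with that of its trace on [U], which is
   empty. *)
have := acc A C Ainf tC nconv U oU CU.
have -> : U `&` A = set0.
  by rewrite setIC; apply/disjoints_subset.
rewrite card_eq_sym card_eq0 => /eqP A0; apply: Ainf.
by rewrite A0; exact: finite_set0.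
Qed.

Theorem theorem6p2 (n : nat) (hn : (1 <= n)%N) (X : topologicalType)
    (hX : S_space n X) :
  S_FC n X <->
  (forall A : set X, infinite_set A ->
     theta_converges n A [set x | theta_complete_accumulation_point n A x] /\
     (forall C : set X, theta_closed n C -> ~ theta_converges n A (~` C) ->
        complete_accumulation_set A C)).
Proof.
split=> [/(S_FC_theta_compact _ hn) cX A Ainf|acc].
  split; first exact: theta_compact_converges.
  by move=> C; exact: theta_compact_accumulation_set.
apply: theta_compact_S_FC => //; apply: accumulation_set_theta_compact => //.
by move=> A C /acc[_]; exact.
Qed.
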